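(* Let $\mathfrak{q}=\mathfrak{l}\oplus\mathfrak{g}(1)\oplus\mathfrak{z}(\mathfrak{n})$ be a maximal parabolic subalgebra of quasi-Heisenberg type of one of the types $B_n(i)$ ($3\le i\le n$), $C_n(i)$ ($2\le i\le n-1$), $D_n(i)$ ($3\le i\le n-3$), $E_6(3)$, $E_6(5)$, $E_7(2)$, $E_7(6)$, $E_8(1)$, $F_4(4)$. Then the covariant map $\tau_2:\mathfrak{g}(1)\to\mathfrak{l}\otimes\mathfrak{z}(\mathfrak{n})$, $\tau_2(X)=\frac12(\mathrm{ad}(X)^2\otimes\mathrm{Id})\omega$, is not identically zero.
   Context: $\mathfrak{g}$ is a complex simple Lie algebra with Borel subalgebra $\mathfrak{b}\supset\mathfrak{h}$ (Cartan), roots $\Delta$, simple roots $\Pi$, Killing form $\kappa$. ''$\mathfrak{q}$ is of type $\mathcal{T}(i)$'' means $\mathfrak{g}$ has type $\mathcal{T}$ and $\mathfrak{q}=\mathfrak{l}\oplus\mathfrak{n}$ is the standard maximal parabolic determined by $\alpha_\mathfrak{q}=\alpha_i$ (Bourbaki numbering): $\mathfrak{l}=\mathfrak{h}$ plus root spaces for roots in $\mathrm{span}(\Pi\setminus\{\alpha_\mathfrak{q}\})$, $\mathfrak{n}$ the remaining positive root spaces. Quasi-Heisenberg type: $[\mathfrak{n},[\mathfrak{n},\mathfrak{n}]]=0$, $\dim[\mathfrak{n},\mathfrak{n}]>1$. Grading by the coefficient of $\alpha_\mathfrak{q}$: $\mathfrak{g}=\bigoplus_{j=-2}^2\mathfrak{g}(j)$,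 $\mathfrak{l}=\mathfrak{g}(0)$, $\mathfrak{z}(\mathfrak{n})=\mathfrak{g}(2)$, $\mathfrak{z}(\bar{\mathfrak{n}})=\mathfrak{g}(-2)$. $\omega=\sum_jX_j^*\otimes X_j\in\mathfrak{z}(\bar{\mathfrak{n}})\otimes\mathfrak{z}(\mathfrak{n})$, with $\{X_j\}$ a basis of $\mathfrak{z}(\mathfrak{n})$ and $\{X_j^*\}$ its $\kappa$-dual basis of $\mathfrak{z}(\bar{\mathfrak{n}})$. *)

(* Defs.v *)
From HB Require Import structures.
From mathcomp Require Import all_boot all_order all_algebra.
From mathcomp Require Import mxtens.

Set Implicit Arguments.
Unset Strict Implicit.
Unset Printing Implicit Defensive.

Import GRing.Theory Num.Theory passmx.
Local Open Scope ring_scope.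

HB.mixin Record Vector_isLie (F : fieldType) V of Vector F V := {
  lieb : V -> V -> V;
  lieb_linearl : forall y : V, linear (lieb^~ y);
  lieb_linearr : forall x : V, linear (lieb x);
  liebxx : forall x : V, lieb x x = 0;
  lieb_jacobi : forall x y z : V,
    lieb x (lieb y z) + lieb y (lieb z x) + lieb z (lieb x y) = 0
}.

#[short(type="lieAlgType")]
HB.structure Definition LieAlgebra (F : fieldType) :=
  {V of Vector_isLie F V & Vector F V}.

Section Tensor.
Context {F : fieldType}.

(* V (x) W is modelled on coordinate rows in the canonical bases [vbasis fullv];
   v (x) w and f (x) g are then Kronecker products. *)
Definition tensor (V W : vectType F) := 'rV[F]_(\dim {:V} * \dim {:W}).

Definition tens {V W : vectType F} (v : V) (w : W) : tensor V W :=
  rVof (vbasis fullv) v *t rVof (vbasis fullv) w.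

Definition tens_hom {V W V' W' : vectType F} (f : 'Hom(V, V')) (g : 'Hom(W, W'))
    (u : tensor V W) : tensor V' W' :=
  u *m (mxof (vbasis fullv) (vbasis fullv) f *t mxof (vbasis fullv) (vbasis fullv) g).

Lemma tens_homE (V W V' W' : vectType F) (f : 'Hom(V, V')) (g : 'Hom(W, W'))
    (v : V) (w : W) : tens_hom f g (tens v w) = tens (f v) (g w).
Proof.
rewrite /tens !(rVof_app _ (vbasisP fullv)).
exact: (tensmx_mul (rVof _ v) (rVof _ w)).
Qed.

End Tensor.

Section LieAlgebraTheory.
Context {F : fieldType} {g : lieAlgType F}.
Implicit Types (x y : g) (U V I : {vspace g}).

HB.instance Definition _ x :=
  GRing.isLinear.Build F g g *:%R (lieb x) (lieb_linearr x).

Definition ad x : 'End(g) := linfun (lieb x).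

Lemma adE x y : ad x y = lieb x y.
Proof. exact: lfunE. Qed.

Definition killing x y : F :=
  \tr (mxof (vbasis {:g}) (vbasis {:g}) (ad x \o ad y)%VF).

Definition lie_prod U V : {vspace g} :=
  <<[seq lieb x y | x <- vbasis U, y <- vbasis V]>>%VS.

Definition lie_center U : {vspace g} :=
  (U :&: \bigcap_(y <- vbasis U) lker (ad y))%VS.

Definition subalgebra U := (lie_prod U U <= U)%VS.

Definition ideal I := (lie_prod fullv I <= I)%VS.

Definition abelian_lie U := lie_prod U U = 0%VS.

Definition solvable_lie U :=
  exists k, iter k (fun V => lie_prod V V) U = 0%VS.

Definition ad_diagonalizable x :=
  exists2 e : seq g, basis_of fullv e &
    forall v, v \in e -> exists a : F, ad x v = a *: v.

Definition cartan_subalgebra (h : {vspace g}) :=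
  [/\ abelian_lie h,
      forall x, (forall y, y \in h -> lieb y x = 0) -> x \in h
    & forall x, x \in h -> ad_diagonalizable x].

Definition borel_subalgebra (b : {vspace g}) :=
  [/\ subalgebra b, solvable_lie b
    & forall b', subalgebra b' -> solvable_lie b' -> (b <= b')%VS -> b' = b].

Definition quasi_heisenberg (n : {vspace g}) :=
  lie_prod n (lie_prod n n) = 0%VS /\ (1 < \dim (lie_prod n n))%N.

Definition dual (h : {vspace g}) := 'Hom(subvs_of h, F^o).

Definition root_space (h : {vspace g}) (alpha : dual h) : {vspace g} :=
  (\bigcap_(H <- vbasis {:subvs_of h}) leigenspace (ad (vsval H)) (alpha H))%VS.

Definition is_root (h : {vspace g}) (alpha : dual h) :=
  (alpha != 0) && (root_space alpha != 0%VS).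

Definition root_system (h : {vspace g}) (Delta : seq (dual h)) :=
  uniq Delta /\ (forall alpha, (alpha \in Delta) = is_root alpha).

Definition is_coroot (h : {vspace g}) (alpha : dual h) (H : subvs_of h) :=
  vsval H \in lie_prod (root_space alpha) (root_space (- alpha)) /\ alpha H = 2.

End LieAlgebraTheory.

Arguments lie_center {F g} U.
Arguments ideal {F g} I.

Definition simple_lie (F : fieldType) (g : lieAlgType F) :=
  ~ abelian_lie {:g} /\
  forall I : {vspace g}, ideal I -> I = 0%VS \/ I = fullv.

(* Vertices are numbered from 1, as in Bourbaki. *)
Inductive dynkin_type :=
  | TypeA of nat | TypeB of nat | TypeC of nat | TypeD of nat
  | TypeE6 | TypeE7 | TypeE8 | TypeF4 | TypeG2.

Definition lie_rank (T : dynkin_type) : nat :=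
  match T with
  | TypeA n | TypeB n | TypeC n | TypeD n => n
  | TypeE6 => 6 | TypeE7 => 7 | TypeE8 => 8 | TypeF4 => 4 | TypeG2 => 2
  end.

Definition dynkin_edge (T : dynkin_type) (i j : nat) : bool :=
  match T with
  | TypeA _ | TypeB _ | TypeC _ | TypeF4 | TypeG2 => j == i.+1
  | TypeD n => ((j == i.+1) && (j < n)%N) || ((i.+2 == n) && (j == n))
  | TypeE6 | TypeE7 | TypeE8 =>
      (i, j) \in [:: (1, 3); (3, 4); (2, 4); (4, 5); (5, 6); (6, 7); (7, 8)]%N
  end.

(* For adjacent vertices: the number of edges joining them if alpha_i is longer
   than alpha_j, and 1 otherwise, i.e. - <alpha_i, alpha_j^vee>. *)
Definition dynkin_lace (T : dynkin_type) (i j : nat) : int :=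
  match T with
  | TypeB n => if (i.+1 == n) && (j == n) then 2 else 1
  | TypeC n => if (i == n) && (j.+1 == n) then 2 else 1
  | TypeF4 => if (i == 2%N) && (j == 3%N) then 2 else 1
  | TypeG2 => if (i == 2%N) && (j == 1%N) then 3 else 1
  | _ => 1
  end.

(* the Cartan integer <alpha_i, alpha_j^vee> *)
Definition cartan_integer (T : dynkin_type) (i j : nat) : int :=
  if i == j then 2
  else if dynkin_edge T i j || dynkin_edge T j i then - dynkin_lace T i j
  else 0.

Section SimpleRoots.
Context {F : numFieldType} {g : lieAlgType F} {h : {vspace g}} {n : nat}.
Implicit Types (Delta : seq (dual h)) (Pi : n.-tuple (dual h)) (alpha : dual h).
Implicit Types (i : 'I_n).

(* The order of a numFieldType is partial in general: 0 <= c forces c to be real. *)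
Definition positive Pi alpha := [forall i, 0 <= coord Pi i alpha].

Definition root_base Delta Pi :=
  [/\ {subset Pi <= Delta}, basis_of fullv Pi
    & forall alpha, alpha \in Delta -> exists k : 'I_n -> nat,
        alpha = \sum_i tnth Pi i *+ k i \/ alpha = - \sum_i tnth Pi i *+ k i].

(* Pi is the base of Delta singled out by the Borel subalgebra b *)
Definition simple_roots (b : {vspace g}) Delta Pi :=
  root_base Delta Pi /\
  b = (h + \sum_(alpha <- Delta | positive Pi alpha) root_space alpha)%VS.

Definition span_but Pi i : {vspace dual h} :=
  <<[seq tnth Pi j | j <- enum 'I_n & j != i]>>%VS.

Definition levi Delta Pi i : {vspace g} :=
  (h + \sum_(alpha <- Delta | alpha \in span_but Pi i) root_space alpha)%VS.

Definition nilrad Delta Pi i : {vspace g} :=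
  (\sum_(alpha <- Delta | positive Pi alpha && (alpha \notin span_but Pi i))
     root_space alpha)%VS.

Definition opp_nilrad Delta Pi i : {vspace g} :=
  (\sum_(alpha <- Delta | positive Pi (- alpha) && (alpha \notin span_but Pi i))
     root_space alpha)%VS.

Definition std_parabolic Delta Pi i : {vspace g} :=
  (levi Delta Pi i + nilrad Delta Pi i)%VS.

Definition grading Delta Pi i (j : int) : {vspace g} :=
  ((if (j == 0)%R then h else 0) +
   \sum_(alpha <- Delta | coord Pi i alpha == j%:~R) root_space alpha)%VS.

End SimpleRoots.

Definition has_type (F : numFieldType) (g : lieAlgType F) (h : {vspace g})
    (T : dynkin_type) (Pi : (lie_rank T).-tuple (dual h)) :=
  forall j : 'I_(lie_rank T), exists2 H : subvs_of h, is_coroot (tnth Pi j) H &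
    forall i : 'I_(lie_rank T), tnth Pi i H = (cartan_integer T i.+1 j.+1)%:~R.

Definition listed (T : dynkin_type) (i : nat) : bool :=
  match T with
  | TypeB n => (3 <= i <= n)%N
  | TypeC n => (2 <= i <= n - 1)%N
  | TypeD n => (3 <= i <= n - 3)%N
  | TypeE6 => i \in [:: 3; 5]%N
  | TypeE7 => i \in [:: 2; 6]%N
  | TypeE8 => i == 1%N
  | TypeF4 => i == 4%N
  | _ => false
  end.

Section CovariantMap.
Context {F : fieldType} {g : lieAlgType F} {m : nat}.

Definition killing_dual (X Xstar : m.-tuple g) :=
  forall j k : 'I_m, killing (tnth Xstar j) (tnth X k) = (j == k)%:R.

Definition omega (X Xstar : m.-tuple g) : tensor g g :=
  \sum_j tens (tnth Xstar j) (tnth X j).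

(* valued in g (x) g, which contains l (x) z(n) *)
Definition tau2 (X Xstar : m.-tuple g) (x : g) : tensor g g :=
  2^-1 *: tens_hom (ad x \o ad x)%VF \1%VF (omega X Xstar).

End CovariantMap.

(* Main.v *)
(* If tau_2 vanished identically, then [X, [X, z]] = 0 for all X in g(1) and z in
   the centre of the opposite nilradical.  Polarising and pairing with H in h,
   kappa(z, [x, y]) = 0 for root vectors x, y in g(1) of distinct weights, and
   since [x, y] lies in z(n), which is dual to z(nbar), [x, y] = 0.  Equal weights
   alpha_q are handled through a Dynkin neighbour of alpha_q, so that the root
   space of alpha_q centralises g(1), and by invariance of kappa it annihilates
   g(-2).  Hence the sum A of the g(-k), k >= 2, is stable under the root spaces
   of all +-alpha_j, and every coroot has trace 0 on A.  The coroots span h, so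
   all of h has trace 0 on A, which forces A = 0 because A has only weights of
   negative degree; by duality [n, n] = 0, a contradiction.  The classification
   enters only through the existence of a neighbour of alpha_q. *)

Require Import Defs.
From HB Require Import structures.
From mathcomp Require Import all_boot all_order all_algebra.
From mathcomp Require Import reals complex mxtens boolp.

Set Implicit Arguments.
Unset Strict Implicit.
Unset Printing Implicit Defensive.

Local Open Scope ring_scope.
Import Order.TTheory GRing.Theory Num.Theory passmx.

Lemma memv_bigcap_seqP {K : fieldType} {vT : vectType K} {I : eqType} {s : seq I}
    {V : I -> {vspace vT}} {v : vT} :
  reflect (forall i, i \in s -> v \in V i) (v \in (\bigcap_(i <- s) V i)%VS).
Proof.
elim: s => [|i s IH]; first by rewrite big_nil memvf; constructor.
rewrite big_cons memv_cap; apply: (iffP andP) => [[vi /IH vs] j|vs].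
  by rewrite inE => /predU1P[->|/vs].
by split; [apply: vs; rewrite mem_head | apply/IH => j js; apply: vs; rewrite inE js orbT].
Qed.

Section LieBracket.
Context {F : fieldType} {g : lieAlgType F}.
Implicit Types (x y z : g) (U V W : {vspace g}).

Lemma liebDr x y z : lieb x (y + z) = lieb x y + lieb x z.
Proof. exact: linearD. Qed.

Lemma liebZr x a y : lieb x (a *: y) = a *: lieb x y.
Proof. exact: linearZ. Qed.

Lemma liebDl x y z : lieb (x + y) z = lieb x z + lieb y z.
Proof. by have := lieb_linearl z 1 x y; rewrite !scale1r. Qed.

Lemma lieb0l x : lieb 0 x = 0.
Proof. by apply: (addrI (lieb 0 x)); rewrite -liebDl !addr0. Qed.

Lemma liebZl a x y : lieb (a *: x) y = a *: lieb x y.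
Proof. by have := lieb_linearl y a x 0; rewrite lieb0l !addr0. Qed.

Lemma liebC x y : lieb x y = - lieb y x.
Proof.
apply/eqP; rewrite -addr_eq0; have := liebxx (x + y).
by rewrite liebDl !liebDr !liebxx add0r addr0 => ->.
Qed.

Lemma lieb_lieb x y z : lieb (lieb x y) z = lieb x (lieb y z) - lieb y (lieb x z).
Proof.
have /eqP := lieb_jacobi x y z; rewrite addr_eq0 => /eqP J.
by rewrite [LHS]liebC (liebC x z) linearN opprK J.
Qed.

Lemma ad_lieb x y : ad (lieb x y) = ((ad x \o ad y) - (ad y \o ad x))%VF.
Proof. by apply/lfunP => z; rewrite add_lfunE opp_lfunE !comp_lfunE !adE lieb_lieb. Qed.

Lemma adD x y : ad (x + y) = ad x + ad y.
Proof. by apply/lfunP => z; rewrite add_lfunE !adE liebDl. Qed.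

Lemma adZ a x : ad (a *: x) = a *: ad x.
Proof. by apply/lfunP => z; rewrite scale_lfunE !adE liebZl. Qed.

Lemma mem_lie_prod U V x y : x \in U -> y \in V -> lieb x y \in lie_prod U V.
Proof.
move=> xU yV; rewrite (coord_vbasis xU) (coord_vbasis yV).
have -> v : lieb (\sum_i coord (vbasis U) i x *: (vbasis U)`_i) v
    = \sum_i coord (vbasis U) i x *: lieb (vbasis U)`_i v.
  by rewrite liebC linear_sum -sumrN; apply: eq_bigr => i _; rewrite linearZ -scalerN -liebC.
apply: rpred_sum => i _; apply: rpredZ; rewrite linear_sum; apply: rpred_sum => j _.
rewrite linearZ; apply: rpredZ; apply/memv_span/allpairsP.
by exists ((vbasis U)`_i, (vbasis V)`_j); rewrite !mem_nth ?size_tuple.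
Qed.

Lemma lie_prod_ind U V (P : g -> Prop) :
    P 0 -> (forall a x y, P x -> P y -> P (a *: x + y)) ->
    (forall x y, x \in U -> y \in V -> P (lieb x y)) ->
  forall x, x \in lie_prod U V -> P x.
Proof.
move=> P0 PD PUV x xUV.
rewrite [x](coord_span (X := in_tuple [seq lieb u v | u <- vbasis U, v <- vbasis V])) //.
have PD' v w : P v -> P w -> P (v + w) by move=> ? ?; rewrite -[v]scale1r; apply: PD.
apply: (big_ind P) => // i _; rewrite -[_ *: _]addr0; apply: PD => //.
have /allpairsP[[u v] /= [uU vV ->]] := mem_nth 0 (ltn_ord i).
by apply: PUV; exact: vbasis_mem.
Qed.

Lemma killingDl x y z : killing (x + y) z = killing x z + killing y z.
Proof. by rewrite /killing adD comp_lfunDl linearD /= raddfD. Qed.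

Lemma killingZl a x y : killing (a *: x) y = a * killing x y.
Proof. by rewrite /killing adZ -comp_lfunZl linearZ /= linearZ. Qed.

Lemma killing_linear y : linear_for *%R (killing^~ y).
Proof. by move=> a u v; rewrite killingDl killingZl. Qed.

Lemma mxof_mul (f f' : 'End(g)) :
  let e := vbasis {:g} in mxof e e (f \o f')%VF = mxof e e f' *m mxof e e f.
Proof. by apply: mxof_comp; exact: vbasisP. Qed.

Lemma killingC x y : killing x y = killing y x.
Proof. by rewrite /killing !mxof_mul mxtrace_mulC. Qed.

Lemma killing_invariant x y z : killing (lieb x y) z = killing x (lieb y z).
Proof.
rewrite /killing !mxof_mul !ad_lieb !linearB /= !mxof_mul.
rewrite mulmxBl !linearB /= !mulmxA; congr (_ - _).
by rewrite [RHS]mxtrace_mulC mulmxA [RHS]mxtrace_mulC mulmxA.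
Qed.

Lemma killing0l y : killing 0 y = 0.
Proof. by rewrite -[0](scale0r 0) killingZl mul0r. Qed.

Lemma killingNl x y : killing (- x) y = - killing x y.
Proof. by rewrite -scaleN1r killingZl mulN1r. Qed.

Lemma killing0r x : killing x 0 = 0. Proof. by rewrite killingC killing0l. Qed.
Lemma killingNr x y : killing x (- y) = - killing x y.
Proof. by rewrite killingC killingNl killingC. Qed.
Lemma killingDr x y z : killing x (y + z) = killing x y + killing x z.
Proof. by rewrite !(killingC x) killingDl. Qed.
Lemma killingZr a x y : killing x (a *: y) = a * killing x y.
Proof. by rewrite !(killingC x) killingZl. Qed.

Lemma killing_suml I (r : seq I) (c : I -> F) (v : I -> g) y :
  killing (\sum_(i <- r) c i *: v i) y = \sum_(i <- r) c i * killing (v i) y.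
Proof.
apply: (big_ind2 (fun u b => killing u y = b)) => [|u b w d <- <-|i _].
- exact: killing0l.
- exact: killingDl.
- exact: killingZl.
Qed.

Lemma killing_sumr I (r : seq I) (c : I -> F) (v : I -> g) y :
  killing y (\sum_(i <- r) c i *: v i) = \sum_(i <- r) c i * killing y (v i).
Proof. by rewrite killingC killing_suml; under eq_bigr do rewrite killingC. Qed.

Lemma simple_killing_nondegenerate x0 y0 x :
  simple_lie g -> killing x0 y0 != 0 -> (forall y, killing x y = 0) -> x = 0.
Proof.
move=> [_ simple_g] x0y0 x_rad.
pose k y : 'Hom(g, F^o) := linfun ((fun u => killing u y : F^o)).
pose rad := (\bigcap_(y <- vbasis {:g}) lker (k y))%VS.
have kE y u : k y u = killing u y.
  have lin_k : linear (fun u => killing u y : F^o) by exact: killing_linear.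
  pose kM := GRing.isLinear.Build F g F^o *:%R (fun u => killing u y : F^o) lin_k.
  pose kL : {linear g -> F^o} := HB.pack (fun u => killing u y : F^o) kM.
  exact: (lfunE kL u).
have radP u : reflect (forall y, killing u y = 0) (u \in rad).
  apply: (iffP memv_bigcap_seqP) => [u_rad y | u_rad y _].
    rewrite (coord_vbasis (memvf y)) killing_sumr big1 // => i _.
    have := u_rad _ (mem_nth 0 _ : (vbasis {:g})`_i \in _); rewrite size_tuple => /(_ (ltn_ord i)).
    by rewrite memv_ker kE => /eqP ->; rewrite mulr0.
  by rewrite memv_ker kE u_rad.
have rad_ideal : ideal rad.
  apply/subvP; apply: (lie_prod_ind (P := fun u => u \in rad)) => [|a u w uR wR|u w _ /radP w_rad].
  - exact: mem0v.
  - by rewrite memvD ?memvZ.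
  by apply/radP => y; rewrite liebC killingNl killing_invariant w_rad oppr0.
case: (simple_g rad rad_ideal) => [rad0|radT].
  by apply/eqP; rewrite -memv0 -rad0; apply/radP.
have /radP/(_ y0)/eqP : x0 \in rad by rewrite radT memvf.
by rewrite (negPf x0y0).
Qed.

End LieBracket.

Section Tau2.
Context {F : numFieldType} {g : lieAlgType F} {m : nat}.

Lemma tens_index (v w : g) p r :
  tens v w 0 (mxtens_index (p, r)) =
  rVof (vbasis {:g}) v 0 p * rVof (vbasis {:g}) w 0 r.
Proof.
by rewrite /tens mxE mxtens_indexK; case: (mxtens_unindex _) => a b; rewrite !ord1.
Qed.

Lemma tau2_eq0 (X Xstar : m.-tuple g) (x : g) : free X ->
  tau2 X Xstar x = 0 -> forall j, lieb x (lieb x (tnth Xstar j)) = 0.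
Proof.
move=> freeX /eqP; rewrite scaler_eq0 invr_eq0 pnatr_eq0 /= => /eqP t0 j.
have t0' : \sum_j tens (lieb x (lieb x (tnth Xstar j))) (tnth X j) = 0.
  rewrite -[RHS]t0 /omega /tens_hom mulmx_suml; apply: eq_bigr => k _.
  have := tens_homE (ad x \o ad x)%VF \1%VF (tnth Xstar k) (tnth X k).
  by rewrite /tens_hom => ->; rewrite comp_lfunE id_lfunE !adE.
apply/eqP; rewrite -(rVof_eq0 (vbasisP _)); apply/eqP/rowP => p; rewrite [RHS]mxE.
have combo : \sum_j rVof (vbasis {:g}) (lieb x (lieb x (tnth Xstar j))) 0 p
    *: tnth X j = 0.
  apply/eqP; rewrite -(rVof_eq0 (vbasisP _)) linear_sum; apply/eqP/rowP => r.
  move/rowP/(_ (mxtens_index (p, r))): t0'.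
  rewrite !summxE [RHS]mxE => {}t0'; rewrite [RHS]mxE -[RHS]t0'; apply: eq_bigr => k _.
  by rewrite linearZ mxE tens_index.
pose c k := rVof (vbasis {:g}) (lieb x (lieb x (tnth Xstar k))) 0 p.
have c0 : \sum_k c k *: X`_k = 0.
  by rewrite -[RHS]combo; apply: eq_bigr => k _; rewrite (tnth_nth 0 X).
exact: (elimT freeP freeX c c0 j).
Qed.

End Tau2.

Section Weights.
Context {F : fieldType} {g : lieAlgType F} {h : {vspace g}}.
Implicit Types (x y z : g) (alpha beta mu : dual h) (H : subvs_of h).

Lemma root_spaceP {alpha x} :
  reflect (forall H, lieb (vsval H) x = (alpha H : F) *: x) (x \in root_space alpha).
Proof.
have eigP (f : 'End(g)) a : (x \in leigenspace f a) = (f x == a *: x).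
  by rewrite memv_ker add_lfunE opp_lfunE scale_lfunE id_lfunE subr_eq0.
apply: (iffP memv_bigcap_seqP) => [eig H|eig H _]; last by rewrite eigP adE eig.
rewrite (coord_vbasis (memvf H)) !linear_sum /= scaler_suml liebC linear_sum -sumrN.
apply: eq_bigr => i _; rewrite !linearZ /= -liebC -scalerA.
congr (_ *: _); apply/eqP; rewrite -adE -eigP.
by apply: eig; rewrite mem_nth // size_tuple.
Qed.

Lemma lieb_root_space alpha beta x y :
  x \in root_space alpha -> y \in root_space beta ->
  lieb x y \in root_space (alpha + beta).
Proof.
move=> /root_spaceP x_alpha /root_spaceP y_beta; apply/root_spaceP => H.
have /eqP := lieb_lieb (vsval H) x y; rewrite eq_sym subr_eq => /eqP ->.
by rewrite x_alpha y_beta liebZl liebZr -scalerDl add_lfunE.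
Qed.

Lemma killing_root_space alpha beta x y :
  x \in root_space alpha -> y \in root_space beta ->
  killing x y != 0 -> alpha + beta = 0.
Proof.
move=> /root_spaceP x_alpha /root_spaceP y_beta xy0; apply/lfunP => H.
rewrite add_lfunE zero_lfunE; apply: (mulIf xy0); rewrite mul0r mulrDl.
have := killing_invariant x (vsval H) y.
rewrite liebC x_alpha y_beta killingNl killingZl killingZr => /eqP.
by rewrite eq_sym -addr_eq0 addrC => /eqP.
Qed.

Lemma dual_basis_ext (c : 'I_(\dim {:subvs_of h}) -> F) :
  exists alpha, forall i : 'I__, alpha (vbasis {:subvs_of h})`_i = c i.
Proof.
pose f H : F^o := \sum_i coord (vbasis {:subvs_of h}) i H * c i.
have lin_f : linear f.
  move=> a u v; rewrite /f scaler_sumr -big_split; apply: eq_bigr => i _ /=.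
  by rewrite linearP mulrDl -mulrA.
pose fM := GRing.isLinear.Build F (subvs_of h) F^o *:%R f lin_f.
pose fL : {linear subvs_of h -> F^o} := HB.pack f fM.
exists (linfun fL) => i; rewrite lfunE /= /f (bigD1 i) //= coord_free ?(basis_free (vbasisP _)) //.
rewrite eqxx mul1r big1 ?addr0 // => j /negPf ji.
by rewrite coord_free ?(basis_free (vbasisP _)) // eq_sym ji mul0r.
Qed.

Lemma ad_diagonalizable_mx x : ad_diagonalizable x ->
  diagonalizable (mxof (vbasis {:g}) (vbasis {:g}) (ad x)).
Proof.
case=> s s_basis s_eig.
pose e : (\dim {:g}).-tuple g := tcast (esym (size_basis (X := in_tuple s) s_basis)) (in_tuple s).
have eE : e = s :> seq g by rewrite val_tcast.
have e_basis : basis_of fullv e by rewrite eE.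
have vb := vbasisP {:g}.
have Punit : mxof e (vbasis {:g}) \1 \in unitmx.
  have eK : mxof e (vbasis {:g}) \1 *m mxof (vbasis {:g}) e \1 = 1%:M.
    by rewrite -mxof_comp // comp_lfun1l mxof1 // (basis_free e_basis).
  by case: (mulmx1_unit eK).
exists (mxof e (vbasis {:g}) \1) => //.
apply/diagonalizable_forPex.
exists (\row_i coord e i (ad x e`_i)).
apply/(simmxP Punit).
have -> : diag_mx (\row_i coord e i (ad x e`_i)) = mxof e e (ad x).
  apply/matrixP => i j; rewrite !mxE vecof_delta.
  have [a ->] := s_eig e`_i ltac:(by rewrite -eE mem_nth // size_tuple).
  rewrite !linearZ /= !coord_free ?(basis_free e_basis) // eqxx eq_sym.
  by case: (j == i); rewrite ?mulr1n ?mulr0n ?mulr0.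
by rewrite -!mxof_comp // comp_lfun1l comp_lfun1r.
Qed.

Lemma weight_basis : cartan_subalgebra h ->
  exists e : (\dim {:g}).-tuple g, basis_of fullv e /\
    forall i : 'I_(\dim {:g}), exists alpha, e`_i \in root_space alpha.
Proof.
move=> [h_abelian _ h_diag]; have vb := vbasisP {:g}.
pose M H := mxof (vbasis {:g}) (vbasis {:g}) (ad (vsval H)).
have [P Punit /allP P_diag] : codiagonalizable [seq M H | H <- vbasis {:subvs_of h}].
  apply/codiagonalizableP; split=> [_ _ /mapP[H _ ->] /mapP[H' _ ->] | _ /mapP[H _ ->]].
    apply/eqP; rewrite -subr_eq0 -!mxof_comp // -linearB -ad_lieb.
    have -> : lieb (vsval H') (vsval H) = 0.
      by apply/eqP; rewrite -memv0 -h_abelian mem_lie_prod ?subvsP.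
    by apply/eqP/matrixP => i j; rewrite !mxE /= adE lieb0l linear0.
  exact/ad_diagonalizable_mx/h_diag/subvsP.
pose e := [tuple vecof (vbasis {:g}) (row i P) | i < \dim {:g}].
have eE (i : 'I__) : e`_i = vecof (vbasis {:g}) (row i P).
  by rewrite -tnth_nth tnth_mktuple.
exists e; split.
  rewrite basisEfree subvf size_tuple leqnn !andbT; apply/freeP => k ke0 i.
  have : \row_i k i = 0.
    apply: (can_inj (mulmxK Punit)); rewrite mul0mx mulmx_sum_row.
    apply/eqP; rewrite -(vecof_eq0 vb) linear_sum -[X in _ == X]ke0; apply/eqP.
    by apply: eq_bigr => j _; rewrite linearZ /= mxE eE.
  by move/rowP/(_ i); rewrite !mxE.
move=> i.
have eig H : H \in vbasis {:subvs_of h} -> exists a : F, lieb (vsval H) e`_i = a *: e`_i.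
  move/(map_f M)/P_diag/diagonalizable_forPex => [D /(simmxP Punit) PD].
  exists (D 0 i); rewrite -adE eE (hom_vecof _ vb) -row_mul PD row_mul row_diag_mx.
  by rewrite -scalemxAl -rowE linearZ.
have eig_l (l : 'I_(\dim {:subvs_of h})) :
    exists a : F, lieb (vsval (vbasis {:subvs_of h})`_l) e`_i = a *: e`_i.
  by apply/eig/mem_nth; rewrite size_tuple ltn_ord.
have [c cP] := fin_all_exists eig_l.
have [alpha alphaE] := dual_basis_ext c.
exists alpha; apply/memv_bigcap_seqP => H /(nthP 0)[l]; rewrite size_tuple => lt_l <-.
rewrite memv_ker add_lfunE opp_lfunE scale_lfunE id_lfunE subr_eq0 adE.
by rewrite (cP (Ordinal lt_l)) -(alphaE (Ordinal lt_l)).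
Qed.

Lemma mem_root_space0 x : cartan_subalgebra h -> (x \in root_space (0 : dual h)) = (x \in h).
Proof.
case=> h_abelian h_max _; apply/idP/idP => [/root_spaceP x0|xh].
  apply: h_max => y yh; have := x0 (vsproj h y).
  by rewrite vsprojK // zero_lfunE scale0r.
apply/root_spaceP => H; rewrite zero_lfunE scale0r; apply/eqP.
by rewrite -memv0 -h_abelian mem_lie_prod ?subvsP.
Qed.

Lemma root_space_neq0_root (Delta : seq (dual h)) alpha x :
  root_system Delta -> x \in root_space alpha -> x != 0 -> alpha != 0 -> alpha \in Delta.
Proof.
move=> [_ ->] x_alpha x0 alpha0; rewrite /is_root alpha0 /=.
by apply: contraNneq x0 => V0; rewrite -memv0 -V0.
Qed.

Lemma coord_weight n (e : n.-tuple g) (w : 'I_n -> dual h) alpha x (k : 'I_n) :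
    basis_of fullv e -> (forall i : 'I_n, e`_i \in root_space (w i)) ->
  x \in root_space alpha -> coord e k x != 0 -> w k = alpha.
Proof.
move=> e_basis e_w /root_spaceP x_alpha xk; apply/lfunP => H; apply: (mulfI xk).
have := congr1 (coord e k) (x_alpha H).
rewrite {1}(coord_basis e_basis (memvf x)) linearZ linear_sum linear_sum (bigD1 k) //=.
rewrite big1 => [|i ik].
  rewrite addr0 linearZ /= (root_spaceP (e_w k)) !linearZ /= coord_free ?(basis_free e_basis) //.
  by rewrite eqxx mulr1 => ->; apply: mulrC.
rewrite linearZ /= (root_spaceP (e_w i)) !linearZ /= coord_free ?(basis_free e_basis) //.
by rewrite (negPf ik) !mulr0.
Qed.

End Weights.

Lemma subv_sum_seq {K : fieldType} {vT : vectType K} {I : eqType} (s : seq I) (P : pred I)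
    (V : I -> {vspace vT}) i : i \in s -> P i -> (V i <= \sum_(j <- s | P j) V j)%VS.
Proof. by move=> i_s Pi; rewrite (big_rem i) //= Pi addvSl. Qed.

Lemma sumv_seq_ind {K : fieldType} {vT : vectType K} {I : eqType} (s : seq I) (P : pred I)
    (V : I -> {vspace vT}) (Q : vT -> Prop) :
    Q 0 -> (forall u v, Q u -> Q v -> Q (u + v)) ->
    (forall i v, i \in s -> P i -> v \in V i -> Q v) ->
  forall v, v \in (\sum_(j <- s | P j) V j)%VS -> Q v.
Proof.
move=> Q0 QD; elim: s => [|i s IH] QV v.
  by rewrite big_nil memv0 => /eqP ->.
have {}IH : forall u, u \in (\sum_(j <- s | P j) V j)%VS -> Q u.
  by apply: IH => j u js; apply: QV; rewrite inE js orbT.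
rewrite big_cons; case: ifP => [Pi|_]; last exact: IH.
by case/memv_addP => u uVi [u' /IH Qu' ->]; apply: QD => //; apply: QV uVi; rewrite ?mem_head.
Qed.

Lemma sum_diag_mulmxC (R : comPzRingType) n (A : pred 'I_n) (M M' : 'M[R]_n) :
    (forall k l, A k -> ~~ A l -> M k l = 0) ->
    (forall k l, A k -> ~~ A l -> M' k l = 0) ->
  \sum_(k | A k) (M *m M') k k = \sum_(k | A k) (M' *m M) k k.
Proof.
move=> M_A M'_A.
have E (N N' : 'M[R]_n) : (forall k l, A k -> ~~ A l -> N k l = 0) ->
    \sum_(k | A k) (N *m N') k k = \sum_(k | A k) \sum_(l | A l) N k l * N' l k.
  move=> N_A; apply: eq_bigr => k Ak; rewrite mxE [LHS](bigID A) /=.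
  by rewrite [X in _ + X]big1 ?addr0 // => l Al; rewrite N_A // mul0r.
rewrite !E // exchange_big /=; apply: eq_bigr => k _; apply: eq_bigr => l _.
exact: mulrC.
Qed.

Section Grading.
Context {F : numFieldType} {g : lieAlgType F} {h : {vspace g}} {n : nat}.
Variables (Delta : seq (dual h)) (Pi : n.-tuple (dual h)) (i : 'I_n).
Hypothesis Delta_roots : root_system Delta.
Hypothesis Pi_base : root_base Delta Pi.
Implicit Types (x y z : g) (alpha beta mu : dual h) (H : subvs_of h).

Let deg : dual h -> F := coord Pi i.

Lemma base_free : free Pi.
Proof. by case: Pi_base => _ /basis_free. Qed.

Lemma coord_base (j k : 'I_n) : coord Pi k (tnth Pi j) = (j == k)%:R.
Proof. by rewrite (tnth_nth 0) coord_free // base_free. Qed.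

Lemma coord_root alpha : alpha \in Delta -> exists k : 'I_n -> nat,
  (forall j, coord Pi j alpha = (k j)%:R) \/ (forall j, coord Pi j alpha = - (k j)%:R).
Proof.
case: Pi_base => _ _ PiD /PiD[k k_alpha]; exists k.
have E j : coord Pi j (\sum_l tnth Pi l *+ k l) = (k j)%:R.
  rewrite linear_sum (bigD1 j) //= big1 => [|l lj].
    by rewrite linearMn /= coord_base eqxx addr0.
  by rewrite linearMn /= coord_base (negPf lj) mul0rn.
by case: k_alpha => ->; [left|right] => j; [|rewrite linearN; congr (- _)]; apply: E.
Qed.

Lemma root_neq0 alpha : alpha \in Delta -> alpha != 0.
Proof. by case: Delta_roots => _ -> /andP[]. Qed.

Lemma deg_root_int alpha : alpha \in Delta -> exists z : int, deg alpha = z%:~R.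
Proof.
by case/coord_root => k [] kE; [exists (k i)|exists (- (k i)%:Z)]; rewrite /deg kE ?mulrNz.
Qed.

Lemma deg_gt0_ge1 alpha : alpha \in Delta -> 0 < deg alpha -> 1 <= deg alpha.
Proof. by case/deg_root_int => z ->; rewrite ltr0z ler1z. Qed.

Lemma deg_gt0_positive alpha : alpha \in Delta -> 0 < deg alpha -> positive Pi alpha.
Proof.
case/coord_root => k [] kE degp; apply/forallP => j; rewrite kE //.
by move: degp; rewrite /deg kE oppr_gt0 ltrn0.
Qed.

Lemma mem_span_but alpha : (alpha \in span_but Pi i) = (deg alpha == 0).
Proof.
apply/idP/eqP => [|deg0].
  pose f := linfun (deg : dual h -> F^o).
  have /subvP sub : (span_but Pi i <= lker f)%VS.
    apply/span_subvP => beta /mapP[j]; rewrite mem_filter => /andP[ji _] ->.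
    by rewrite memv_ker lfunE /= /deg coord_base (negPf ji).
  by move/sub; rewrite memv_ker lfunE => /eqP.
have [_ Pi_basis _] := Pi_base.
rewrite (coord_basis Pi_basis (memvf alpha)); apply: rpred_sum => j _.
have [-> | ji] := eqVneq j i; first by rewrite -/deg deg0 scale0r mem0v.
rewrite memvZ // memv_span // -tnth_nth; apply/mapP; exists j => //.
by rewrite mem_filter ji mem_enum.
Qed.

Lemma root_space_nilrad alpha x : alpha \in Delta -> 0 < deg alpha ->
  x \in root_space alpha -> x \in nilrad Delta Pi i.
Proof.
move=> alphaD deg_gt0; apply/subvP; apply: subv_sum_seq => //.
by rewrite deg_gt0_positive //= mem_span_but gt_eqF.
Qed.

Lemma nilrad_ind (Q : g -> Prop) :
    Q 0 -> (forall x y, Q x -> Q y -> Q (x + y)) ->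
    (forall alpha x, alpha \in Delta -> 0 < deg alpha -> x \in root_space alpha -> Q x) ->
  forall x, x \in nilrad Delta Pi i -> Q x.
Proof.
move=> Q0 QD QV; apply: sumv_seq_ind => // alpha x alphaD /andP[/forallP/(_ i) ge0 nspan].
by apply: QV => //; rewrite lt_def ge0 andbT -mem_span_but.
Qed.

Lemma lie_prod_nilrad_ind (Q : g -> Prop) :
    Q 0 -> (forall a x y, Q x -> Q y -> Q (a *: x + y)) ->
    (forall alpha beta x y, alpha \in Delta -> beta \in Delta ->
       0 < deg alpha -> 0 < deg beta ->
       x \in root_space alpha -> y \in root_space beta -> Q (lieb x y)) ->
  forall v, v \in lie_prod (nilrad Delta Pi i) (nilrad Delta Pi i) -> Q v.
Proof.
move=> Q0 QD QV; apply: lie_prod_ind => // x y xn yn.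
have QD1 u v : Q u -> Q v -> Q (u + v) by rewrite -{2}[u]scale1r; apply: QD.
move: x xn; apply: nilrad_ind => [|x x'|alpha x aD deg_a x_a]; first by rewrite lieb0l.
  by rewrite liebDl; apply: QD1.
move: y yn; apply: nilrad_ind => [|y y'|beta y bD deg_b y_b]; first by rewrite linear0.
  by rewrite liebDr; apply: QD1.
exact: QV aD bD deg_a deg_b x_a y_b.
Qed.

Lemma root_space_grading alpha x j : alpha \in Delta -> deg alpha = j%:~R ->
  x \in root_space alpha -> x \in grading Delta Pi i j.
Proof.
move=> alphaD degE x_alpha; rewrite -[x]add0r memv_add ?mem0v //.
by move: x x_alpha; apply/subvP; apply: subv_sum_seq => //; rewrite -/deg degE.
Qed.

Lemma lieb_center alpha beta x y :
    lie_prod (nilrad Delta Pi i) (lie_prod (nilrad Delta Pi i) (nilrad Delta Pi i)) = 0%VS ->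
    alpha \in Delta -> beta \in Delta -> 0 < deg alpha -> 0 < deg beta ->
    x \in root_space alpha -> y \in root_space beta ->
  lieb x y \in lie_center (nilrad Delta Pi i).
Proof.
move=> nil alphaD betaD deg_a deg_b x_a y_b.
have xn := root_space_nilrad alphaD deg_a x_a.
have yn := root_space_nilrad betaD deg_b y_b.
rewrite memv_cap; apply/andP; split.
  have [->|xy0] := eqVneq (lieb x y) 0; first exact: mem0v.
  have xy_ab := lieb_root_space x_a y_b.
  have deg_ab : 0 < deg (alpha + beta) by rewrite [deg _]linearD addr_gt0.
  apply: (root_space_nilrad _ _ xy_ab) => //; apply: (root_space_neq0_root _ xy_ab) => //.
  by apply: contraTneq deg_ab => ->; rewrite /deg linear0 ltxx.
apply/memv_bigcap_seqP => z /vbasis_mem zn; rewrite memv_ker adE -memv0 -nil.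
by rewrite !mem_lie_prod.
Qed.

Lemma lie_prod_nilrad_center :
    lie_prod (nilrad Delta Pi i) (lie_prod (nilrad Delta Pi i) (nilrad Delta Pi i)) = 0%VS ->
  (lie_prod (nilrad Delta Pi i) (nilrad Delta Pi i) <= lie_center (nilrad Delta Pi i))%VS.
Proof.
move=> nil; apply/subvP; apply: lie_prod_nilrad_ind => [|a x y xc yc|alpha beta x y].
- exact: mem0v.
- by rewrite memvD ?memvZ.
exact: lieb_center.
Qed.

End Grading.

Lemma killing_weight_eq0 (F : fieldType) (g : lieAlgType F) (h : {vspace g}) (x : g) :
    cartan_subalgebra h -> (forall x : g, (forall y, killing x y = 0) -> x = 0) ->
    (forall (beta : dual h) y, y \in root_space beta -> killing x y = 0) ->
  x = 0.
Proof.
move=> h_cartan nondeg x0; apply: nondeg => y.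
have [e [e_basis e_w]] := weight_basis h_cartan.
rewrite (coord_basis e_basis (memvf y)) killing_sumr big1 // => i _.
by have [beta e_beta] := e_w i; rewrite (x0 _ _ e_beta) mulr0.
Qed.

Lemma killing_coroot (F : fieldType) (g : lieAlgType F) (h : {vspace g})
    (alpha : dual h) (v : g) (H H' : subvs_of h) :
    v \in lie_prod (root_space alpha) (root_space (- alpha)) ->
  killing v (vsval H) * alpha H' = killing v (vsval H') * alpha H.
Proof.
move: v; apply: lie_prod_ind => [|a x y IHx IHy|x y /root_spaceP x_a /root_spaceP y_a].
- by rewrite !killing0l !mul0r.
- by rewrite !killingDl !killingZl !mulrDl -!mulrA IHx IHy.
have E K : killing (lieb x y) (vsval K) = alpha K * killing x y.
  by rewrite killing_invariant liebC killingNr y_a killingZr opp_lfunE mulNr opprK.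
by rewrite !E mulrAC [RHS]mulrAC; congr (_ * _); apply: mulrC.
Qed.

Section Trace.
Context {F : numFieldType} {g : lieAlgType F} {h : {vspace g}} {n : nat}.
Variables (Delta : seq (dual h)) (Pi : n.-tuple (dual h)) (i : 'I_n).
Variable Hc : 'I_n -> subvs_of h.
Hypothesis h_cartan : cartan_subalgebra h.
Hypothesis nondeg : forall x : g, (forall y, killing x y = 0) -> x = 0.
Hypothesis Delta_roots : root_system Delta.
Hypothesis Pi_base : root_base Delta Pi.
Hypothesis Hc_coroot : forall j, is_coroot (tnth Pi j) (Hc j).
Implicit Types (x y z : g) (alpha beta mu : dual h) (H : subvs_of h).

Let deg : dual h -> F := coord Pi i.

Lemma killing_coroot_neq0 j : killing (vsval (Hc j)) (vsval (Hc j)) != 0.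
Proof.
have [Hprod Hj2] := Hc_coroot j.
apply/negP => /eqP HH0.
have Hj0 : vsval (Hc j) = 0.
  apply: (killing_weight_eq0 h_cartan nondeg) => beta y y_beta.
  have [beta0|beta0] := eqVneq beta 0.
    have yh : y \in h by rewrite -mem_root_space0 // -beta0.
    have := killing_coroot (vsproj h y) (Hc j) Hprod.
    rewrite vsprojK // HH0 mul0r Hj2 => /eqP.
    by rewrite mulf_eq0 pnatr_eq0 orbF => /eqP.
  apply/eqP; apply: contraNT beta0 => k0.
  have Hj_0 : vsval (Hc j) \in root_space (0 : dual h) by rewrite mem_root_space0 // subvsP.
  by rewrite -(killing_root_space Hj_0 y_beta k0) add0r.
have Hc0 : Hc j = 0 by apply/subvs_inj; rewrite Hj0 linear0.
by move: Hj2; rewrite Hc0 linear0 => /eqP; rewrite eq_sym pnatr_eq0.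
Qed.

Lemma coroot_basis : basis_of {:subvs_of h} [tuple Hc j | j < n].
Proof.
have [_ Pi_basis _] := Pi_base.
have dimh : \dim {:subvs_of h} = n.
  rewrite -(size_basis Pi_basis) !dimvf; exact: esym (muln1 _).
rewrite basisEfree subvf size_tuple dimh leqnn !andbT.
have HcE (k : 'I_n) : [tuple Hc j | j < n]`_k = Hc k by rewrite -tnth_nth tnth_mktuple.
apply/freeP => b b0 j.
have : \sum_k (b k * (killing (vsval (Hc k)) (vsval (Hc k)) / 2)) *: Pi`_k = 0.
  apply/lfunP => H; rewrite zero_lfunE sum_lfunE.
  have S0 : \sum_k b k * killing (vsval (Hc k)) (vsval H) = 0.
    rewrite -killing_suml -[RHS](killing0l (vsval H)); congr killing.
    transitivity (vsval (0 : subvs_of h)); last exact: linear0.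
    by rewrite -b0 linear_sum; apply: eq_bigr => k _; rewrite linearZ HcE.
  rewrite -[RHS]S0; apply: eq_bigr => k _.
  have [Hprod Hk2] := Hc_coroot k.
  rewrite scale_lfunE -tnth_nth; have := killing_coroot (Hc k) H Hprod.
  rewrite Hk2 -[_ *: _]/(_ * _) => E.
  by rewrite -mulrA mulrAC E mulfK // pnatr_eq0.
move/(freeP (basis_free Pi_basis)) => /(_ j)/eqP.
by rewrite !mulf_eq0 invr_eq0 pnatr_eq0 (negPf (killing_coroot_neq0 j)) !orbF => /eqP.
Qed.

Lemma coroot_ext alpha : (forall j, alpha (Hc j) = 0) -> alpha = 0.
Proof.
move=> alpha0; apply/lfunP => H; rewrite zero_lfunE (coord_basis coroot_basis (memvf H)).
rewrite linear_sum big1 // => j _.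
rewrite linearZ -tnth_nth tnth_mktuple.
by apply/eqP; rewrite scaler_eq0; apply/orP; right; apply/eqP/alpha0.
Qed.

Section WeightSpaces.
Variables (e : (\dim {:g}).-tuple g) (w : 'I_(\dim {:g}) -> dual h).
Hypothesis e_basis : basis_of fullv e.
Hypothesis e_w : forall k : 'I_(\dim {:g}), e`_k \in root_space (w k).

Let low k := deg (w k) <= - 2.

(* [M x] is the matrix of [ad x] on row vectors, so that products are reversed. *)
Let M x : 'M_(\dim {:g}) := \matrix_(k, l) coord e l (lieb x e`_k).

Lemma mx_ad_lieb x y : M (lieb x y) = M y *m M x - M x *m M y.
Proof.
have E u v (k l : 'I_(\dim {:g})) : coord e l (lieb u (lieb v e`_k)) = (M v *m M u) k l.
  rewrite {1}[lieb v _](coord_basis e_basis (memvf _)) !linear_sum mxE /=.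
  by apply: eq_bigr => p _; rewrite !linearZ /= !mxE.
by apply/matrixP => k l; rewrite !mxE lieb_lieb linearB /= !E !mxE.
Qed.

Let stable x := forall k l, low k -> ~~ low l -> M x k l = 0.

Lemma deg_weight_int k : exists z : int, deg (w k) = z%:~R.
Proof.
have [->|wk0] := eqVneq (w k) 0; first by exists 0; rewrite /deg linear0.
apply: (deg_root_int i Pi_base); apply: (root_space_neq0_root Delta_roots (e_w k)) => //.
by apply: contraTneq (basis_free e_basis) => ek0; apply/negP => /free_not0;
  move/(_ e`_k); rewrite mem_nth ?size_tuple // ek0 eqxx => /(_ isT).
Qed.

Lemma stable_root_space mu x :
    x \in root_space mu ->
    (deg mu <= 0) || (deg mu == 1) && [forall k, (deg (w k) == - 2) ==> (lieb x e`_k == 0)] ->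
  stable x.
Proof.
move=> x_mu deg_mu k l lk; apply: contraNeq; rewrite mxE => kl0.
have wl : w l = mu + w k.
  by apply: (coord_weight (k := l) e_basis e_w _ kl0); apply: lieb_root_space.
rewrite /low wl [deg _]linearD /=.
case/orP: deg_mu => [mu0|/andP[/eqP mu1 /forallP/(_ k) ann]].
  by rewrite -[- 2]add0r lerD.
have [z zE] := deg_weight_int k.
have [dk|dk] := eqVneq (deg (w k)) (- 2).
  by move: ann kl0; rewrite dk eqxx /= => /eqP ->; rewrite linear0 eqxx.
rewrite -/deg mu1; move: lk dk; rewrite /low zE.
rewrite -[- 2]/((- 2)%:~R) -[1]/(1%:~R) -intrD eqr_int !ler_int.
by case: z {zE} => [|[|[|z]]].
Qed.

(* The simple coroots span [h] and, being sums of brackets of operators that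
   stabilise the span of the low weight vectors, have trace 0 on it; so the sum
   of the low weights vanishes, although each of them has negative degree. *)
Lemma low_trace_zero :
    (forall j alpha x, (alpha == tnth Pi j) || (alpha == - tnth Pi j) ->
       x \in root_space alpha -> stable x) ->
  forall k, ~~ low k.
Proof.
move=> simple_stable.
pose T x := \sum_(k | low k) M x k k.
have T_prod j v : v \in lie_prod (root_space (tnth Pi j)) (root_space (- tnth Pi j)) -> T v = 0.
  move: v; apply: lie_prod_ind => [|a x y Tx Ty|x y x_a y_a].
  - by rewrite /T big1 // => k _; rewrite mxE lieb0l linear0.
  - transitivity (a * T x + T y); last by rewrite Tx Ty mulr0 addr0.
    rewrite /T mulr_sumr -big_split; apply: eq_bigr => k _.
    by rewrite !mxE liebDl liebZl linearP.
  rewrite /T mx_ad_lieb; under eq_bigr do rewrite !mxE.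
  rewrite sumrB; apply/eqP; rewrite subr_eq0; apply/eqP.
  have sx : stable x by apply: (simple_stable j (tnth Pi j)); rewrite ?eqxx.
  have sy : stable y by apply: (simple_stable j (- tnth Pi j)); rewrite ?eqxx ?orbT.
  by have := sum_diag_mulmxC sy sx; under eq_bigr do rewrite !mxE; move=> ->;
     apply: eq_bigr => k _; rewrite !mxE.
have W0 : \sum_(k | low k) w k = 0.
  apply: coroot_ext => j; rewrite sum_lfunE.
  have [/T_prod Tj _] := Hc_coroot j; rewrite -[RHS]Tj; apply: eq_bigr => k _.
  rewrite mxE (root_spaceP (e_w k)) linearZ /= coord_free ?(basis_free e_basis) //.
  by rewrite eqxx mulr1.
have degW : \sum_(k | low k) - deg (w k) = 0.
  by rewrite sumrN -[X in - X]linear_sum W0 /deg linear0 oppr0.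
move=> k; apply/negP => lk.
have ge0 l : low l -> 0 <= - deg (w l).
  by move=> ll; rewrite oppr_ge0 (le_trans ll) // oppr_le0 ler0n.
have /eqP := psumr_eq0P ge0 degW lk; rewrite oppr_eq0 => /eqP dk0.
by move: lk; rewrite /low dk0 oppr_ge0 lern0.
Qed.

End WeightSpaces.
End Trace.

Section Commutators.
Context {F : numFieldType} {g : lieAlgType F} {h : {vspace g}} {n m : nat}.
Variables (Delta : seq (dual h)) (Pi : n.-tuple (dual h)) (i : 'I_n).
Variable Hc : 'I_n -> subvs_of h.
Variables X Xstar : m.-tuple g.
Hypothesis h_cartan : cartan_subalgebra h.
Hypothesis nondeg : forall x : g, (forall y, killing x y = 0) -> x = 0.
Hypothesis Delta_roots : root_system Delta.
Hypothesis Pi_base : root_base Delta Pi.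
Hypothesis Hc_coroot : forall j, is_coroot (tnth Pi j) (Hc j).
Hypothesis two_step : lie_prod (nilrad Delta Pi i)
  (lie_prod (nilrad Delta Pi i) (nilrad Delta Pi i)) = 0%VS.
Hypothesis X_basis : basis_of (lie_center (nilrad Delta Pi i)) X.
Hypothesis X_dual : killing_dual X Xstar.
Hypothesis quad0 : forall x, x \in grading Delta Pi i 1 ->
  forall j, lieb x (lieb x (tnth Xstar j)) = 0.
Implicit Types (x y z : g) (alpha beta mu : dual h) (H : subvs_of h).

Let deg : dual h -> F := coord Pi i.

Lemma center_eq0 v : v \in lie_center (nilrad Delta Pi i) ->
  (forall j, killing (tnth Xstar j) v = 0) -> v = 0.
Proof.
move=> vc v0; rewrite (coord_basis X_basis vc) big1 // => j _.
have := v0 j; rewrite {1}(coord_basis X_basis vc) killing_sumr (bigD1 j) //=.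
rewrite -tnth_nth X_dual eqxx mulr1 big1 => [|k kj].
  by rewrite addr0 => ->; rewrite scale0r.
by rewrite -tnth_nth X_dual eq_sym (negPf kj) mulr0.
Qed.

Lemma deg1_neq0 alpha : deg alpha = 1 -> alpha != 0.
Proof. by apply: contra_eq_neq => ->; rewrite /deg linear0 eq_sym oner_eq0. Qed.

Lemma deg1_root_commute alpha beta x y :
    deg alpha = 1 -> deg beta = 1 -> alpha != beta ->
    x \in root_space alpha -> y \in root_space beta ->
  lieb x y = 0.
Proof.
move=> deg_a deg_b ab x_a y_b.
have [->|x0] := eqVneq x 0; first exact: lieb0l.
have [->|y0] := eqVneq y 0; first exact: linear0.
have aD := root_space_neq0_root Delta_roots x_a x0 (deg1_neq0 deg_a).
have bD := root_space_neq0_root Delta_roots y_b y0 (deg1_neq0 deg_b).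
apply: center_eq0 => [|j].
  by apply: (lieb_center (Pi := Pi) (i := i) Delta_roots Pi_base two_step aD bD _ _ x_a y_b);
    rewrite -/deg ?deg_a ?deg_b ltr01.
set z := tnth Xstar j; set w := lieb x y.
have xg : x \in grading Delta Pi i 1 by apply: root_space_grading x_a; rewrite // -/deg deg_a.
have yg : y \in grading Delta Pi i 1 by apply: root_space_grading y_b; rewrite // -/deg deg_b.
have polar : lieb x (lieb y z) + lieb y (lieb x z) = 0.
  have := quad0 (memvD xg yg) j; rewrite -/z !liebDl !liebDr.
  by rewrite (quad0 xg) (quad0 yg) add0r addr0.
apply/eqP; apply: contraNT ab => zw0; apply/eqP/lfunP => H.
apply: (mulIf zw0).
have /eqP := congr1 (killing (vsval H)) polar.
rewrite killing0r killingDr -!(killing_invariant (vsval H)) (root_spaceP x_a) (root_spaceP y_b).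
rewrite !killingZl -(killing_invariant x) -(killing_invariant y) [lieb y x]liebC killingNl.
by rewrite mulrN subr_eq0 (killingC z) => /eqP.
Qed.

Hypothesis neighbour : exists2 j, j != i & tnth Pi i (Hc j) != 0.

(* If [w = lieb x y <> 0] with [x, y] of weight alpha_i, then [w] is killed by
   the root vectors of weight +-alpha_j, hence by the coroot of alpha_j, which
   acts on it by [2 alpha_i(H_j) <> 0]. *)
Lemma simple_commute beta x y : deg beta = 1 ->
  x \in root_space (tnth Pi i) -> y \in root_space beta -> lieb x y = 0.
Proof.
move=> deg_b x_i y_b.
have deg_i : deg (tnth Pi i) = 1 by rewrite /deg (coord_base Pi_base) eqxx.
have [b_i|] := eqVneq (tnth Pi i) beta; last first.
  by move=> ib; apply: deg1_root_commute ib x_i y_b.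
rewrite -{}b_i in y_b; have [j ji ij0] := neighbour.
have commute_j alpha u : (alpha == tnth Pi j) || (alpha == - tnth Pi j) ->
    u \in root_space alpha -> lieb u (lieb x y) = 0.
  move=> alphaE u_a.
  have deg_a : deg alpha = 0.
    by case/orP: alphaE => /eqP ->; rewrite /deg ?linearN /= (coord_base Pi_base) (negPf ji) ?oppr0.
  have alpha0 : alpha != 0.
    have PiD : tnth Pi j \in Delta by case: Pi_base => sub _ _; apply/sub/mem_tnth.
    by case/orP: alphaE => /eqP ->; rewrite ?oppr_eq0 (root_neq0 Delta_roots).
  have shift v v' : v \in root_space (tnth Pi i) -> v' \in root_space (tnth Pi i) ->
      lieb v (lieb v' u) = 0.
    move=> v_i v'_i; apply: (deg1_root_commute deg_i _ _ v_i (lieb_root_space v'_i u_a)).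
      by rewrite [deg _]linearD /= -/deg deg_i deg_a addr0.
    by rewrite -subr_eq0 opprD addrA subrr sub0r oppr_eq0.
  by rewrite liebC lieb_lieb !shift // subrr oppr0.
have [Hprod _] := Hc_coroot j.
have H0 : lieb (vsval (Hc j)) (lieb x y) = 0.
  move: (vsval _) Hprod; apply: lie_prod_ind => [|a u v Hu Hv|u v u_j v_j].
  - exact: lieb0l.
  - by rewrite liebDl liebZl Hu Hv scaler0 addr0.
  rewrite lieb_lieb (commute_j _ _ _ u_j) ?eqxx // (commute_j _ _ _ v_j) ?eqxx ?orbT //.
  by rewrite !linear0 addr0.
have /root_spaceP/(_ (Hc j)) := lieb_root_space x_i y_b.
rewrite H0 add_lfunE => /esym/eqP; rewrite scaler_eq0 -mulr2n -mulr_natr mulf_eq0.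
by rewrite pnatr_eq0 (negPf ij0) => /eqP.
Qed.

Lemma simple_annihilates nu x z : deg nu = - 2 ->
  x \in root_space (tnth Pi i) -> z \in root_space nu -> lieb x z = 0.
Proof.
move=> deg_nu x_i z_nu; apply: (killing_weight_eq0 h_cartan nondeg) => beta y y_b.
have [//|k0] := eqVneq (killing (lieb x z) y) 0.
have /(congr1 deg) := killing_root_space (lieb_root_space x_i z_nu) y_b k0.
rewrite /deg !linearD linear0 /= (coord_base Pi_base) eqxx -/deg deg_nu => deg_b.
rewrite liebC killingNl killing_invariant (simple_commute _ x_i y_b) ?killing0r ?oppr0 //.
by move/eqP: deg_b; rewrite -[2](natrD _ 1 1) opprD addrA subrr sub0r addrC subr_eq0 => /eqP.
Qed.

Lemma nilrad_abelian : lie_prod (nilrad Delta Pi i) (nilrad Delta Pi i) = 0%VS.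
Proof.
have [e [e_basis /fin_all_exists[w e_w]]] := weight_basis h_cartan.
have no_low : forall k, ~~ (deg (w k) <= - 2).
  apply: (low_trace_zero h_cartan nondeg Pi_base Hc_coroot e_basis e_w) => j alpha x alphaE x_a.
  apply: (stable_root_space Delta_roots Pi_base e_basis e_w x_a).
  have deg_j : coord Pi i (tnth Pi j) = (j == i)%:R by rewrite (coord_base Pi_base).
  case/orP: alphaE x_a => /eqP -> x_a; last by rewrite linearN /= deg_j oppr_le0 ler0n.
  rewrite deg_j; have [ji|_] := eqVneq j i; last by rewrite lexx.
  rewrite eqxx /= orbC; apply/orP; left; apply/forallP => k; apply/implyP => /eqP wk.
  by rewrite ji in x_a; rewrite (simple_annihilates wk x_a (e_w k)).
apply/eqP; rewrite -subv0; apply/subvP.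
apply: (lie_prod_nilrad_ind Pi_base (Q := fun v => v \in 0%VS)).
- exact: mem0v.
- by move=> a x y x0 y0; rewrite memvD ?memvZ.
move=> alpha beta x y aD bD deg_a deg_b x_a y_b; rewrite memv0; apply/eqP.
apply: nondeg => z; rewrite (coord_basis e_basis (memvf z)) killing_sumr big1 // => k _.
have [->|k0] := eqVneq (killing (lieb x y) e`_k) 0; first by rewrite mulr0.
have /(congr1 deg) := killing_root_space (lieb_root_space x_a y_b) (e_w k) k0.
rewrite /deg !linearD linear0 /= -/deg => /eqP; rewrite addrC addr_eq0 => /eqP deg_k.
have := no_low k; rewrite deg_k lerN2 -[2](natrD _ 1 1) lerD //.
  exact: (deg_gt0_ge1 Pi_base aD deg_a).
exact: (deg_gt0_ge1 Pi_base bD deg_b).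
Qed.

End Commutators.

Lemma listed_neighbour (T : dynkin_type) (i : 'I_(lie_rank T)) : listed T i.+1 ->
  exists2 j : 'I_(lie_rank T), j != i & cartan_integer T i.+1 j.+1 != 0.
Proof.
have neqS k : (k.+1 == k) = false by rewrite gtn_eqF.
case: T i => [n|n|n|n|||||] [[|i] lt_i] //= listed_i.
- exists (Ordinal (ltnW lt_i)); first by rewrite -val_eqE /= neq_ltn ltnSn.
  by rewrite /cartan_integer /= eqSS neqS eqxx orbT oppr_eq0; case: ifP.
- exists (Ordinal (ltnW lt_i)); first by rewrite -val_eqE /= neq_ltn ltnSn.
  by rewrite /cartan_integer /= eqSS neqS eqxx orbT oppr_eq0; case: ifP.
- exists (Ordinal (ltnW lt_i)); first by rewrite -val_eqE /= neq_ltn ltnSn.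
  rewrite /cartan_integer /= !eqSS neqS eqxx /=.
  have -> : (i.+2 < n)%N.
    case/andP: listed_i => _ /leq_ltn_trans; apply.
    by rewrite ltn_subrL (leq_ltn_trans _ lt_i).
  by rewrite orbT.
- by case: i lt_i listed_i => [|[|[|[|[]]]]] // lt_i _;
    exists (inord 3); rewrite -?val_eqE /= ?inordK.
- by case: i lt_i listed_i => [|[|[|[|[|[]]]]]] // lt_i _;
    [exists (inord 3) | exists (inord 4)]; rewrite -?val_eqE /= ?inordK.
- by exists (inord 2); rewrite -?val_eqE /= ?inordK.
- by case: i lt_i listed_i => [|[|[|[]]]] // lt_i _; exists (inord 2); rewrite -?val_eqE /= ?inordK.
Qed.

Theorem proposition7p3 (R : realType) (g : lieAlgType R[i])
    (h b : {vspace g}) (Delta : seq (dual h))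
    (T : dynkin_type) (Pi : (lie_rank T).-tuple (dual h)) (i : 'I_(lie_rank T))
    (q : {vspace g}) (m : nat) (X Xstar : m.-tuple g) :
  simple_lie g ->
  cartan_subalgebra h -> borel_subalgebra b -> (h <= b)%VS ->
  root_system Delta -> simple_roots b Delta Pi -> has_type Pi ->
  q = std_parabolic Delta Pi i ->
  quasi_heisenberg (nilrad Delta Pi i) ->
  listed T i.+1 ->
  basis_of (lie_center (nilrad Delta Pi i)) X ->
  basis_of (lie_center (opp_nilrad Delta Pi i)) Xstar ->
  killing_dual X Xstar ->
  exists2 x : g, x \in grading Delta Pi i 1 & tau2 X Xstar x != 0.
Proof.
move=> simple_g h_cartan _ _ Delta_roots [Pi_base _] Pi_type _ [two_step dim_nn] iT.
move=> X_basis _ X_dual.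
apply: contrapT => no_x.
have quad0 x : x \in grading Delta Pi i 1 -> forall j, lieb x (lieb x (tnth Xstar j)) = 0.
  move=> xg; apply: (tau2_eq0 (basis_free X_basis)); apply/eqP; apply: contraT => t0.
  by case: no_x; exists x.
have coroot_ex (j : 'I_(lie_rank T)) : exists H : subvs_of h, is_coroot (tnth Pi j) H /\
    forall k : 'I_(lie_rank T), tnth Pi k H = (cartan_integer T k.+1 j.+1)%:~R.
  by have [H] := Pi_type j; exists H.
have [Hc HcP] := fin_all_exists coroot_ex.
have m_gt0 : (0 < m)%N.
  rewrite -(size_basis X_basis) (leq_trans (ltnW dim_nn)) // dimvS //.
  exact: lie_prod_nilrad_center.
have killing1 : killing (tnth Xstar (Ordinal m_gt0)) (tnth X (Ordinal m_gt0)) != 0.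
  by rewrite X_dual eqxx oner_eq0.
have nondeg (x : g) : (forall y, killing x y = 0) -> x = 0.
  exact: simple_killing_nondegenerate simple_g killing1.
have [j ji ij0] := listed_neighbour iT.
have neighbour : exists2 k, k != i & tnth Pi i (Hc k) != 0.
  by exists j => //; case: (HcP j) => _ ->; rewrite intr_eq0.
have coroots k : is_coroot (tnth Pi k) (Hc k) by case: (HcP k).
have nn0 := nilrad_abelian h_cartan nondeg Delta_roots Pi_base coroots two_step
  X_basis X_dual quad0 neighbour.
by rewrite nn0 dimv0 in dim_nn.
Qed.
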